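(* Let $A$ be a commutative ring with unity, let $n\geq1$, let $f(t)=t^n-f_1t^{n-1}+f_2t^{n-2}-\cdots+(-1)^nf_n$ be a polynomial with coefficients in $A$, and let $\tau_1,\dots,\tau_n$ be the universal roots of $f$ in the splitting algebra $A_f$. Let $\varphi:A_f\to B$ be a homomorphism of $A$-algebras. Then for every polynomial $h(t_1,\dots,t_n)$ with coefficients in $A$ that is invariant under the action of $\mathfrak S_n$ permuting the variables $t_1,\dots,t_n$, the element $h(\varphi(\tau_1),\varphi(\tau_2),\dots,\varphi(\tau_n))$ of $B$ lies in (the image of) $A$. In particular, the discriminant $\operatorname{Dis}(f)$ lies in $A$, and if $\operatorname{Dis}(f)$ is regular in $A$, then $A$ is the ring of invariants of $A_f$ under the action of $\mathfrak S_n$.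
   Context: Rings are commutative with unity. An element of a ring is regular if it is neither zero nor a zero divisor. Splitting algebra: for $f(t)=t^n-f_1t^{n-1}+\cdots+(-1)^nf_n$ in $A[t]$, $A_f$ is the quotient of the polynomial ring $A[t_1,\dots,t_n]$ by the ideal generated by $s_1-f_1,\dots,s_n-f_n$, where $s_1,\dots,s_n$ are the elementary symmetric functions of $t_1,\dots,t_n$. The universal roots $\tau_1,\dots,\tau_n$ are the classes of $t_1,\dots,t_n$; thus $f(t)=(t-\tau_1)\cdots(t-\tau_n)$ in $A_f[t]$. The structure map $A\to A_f$ is injective, and $A$ is regarded as a subring of $A_f$. Discriminant: $\operatorname{Dis}(f)=(-1)^{n(n-1)/2}\prod_{i\neq j}(\tau_i-\tau_j)=\prod_{i>j}(\tau_i-\tau_j)^2$, an element of $A_f$. Action: $\mathfrak S_n$ is the group of permutations of $\{1,\dots,n\}$; each $\sigma\in\mathfrak S_n$ acts on $A_f$ by the $A$-algebra automorphism $\varphi_\sigma$ determined by $\varphi_\sigma(\tau_i)=\tau_{\sigma^{-1}(i)}$. The ring of invariants is the subring of elements fixed by all $\varphi_\sigma$. *)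

(* Defs.v *)
From HB Require Import structures.
From mathcomp Require Import all_boot all_order all_algebra all_fingroup.
From mathcomp Require Import generic_quotient ring_quotient boolp mpoly.

Set Implicit Arguments.
Unset Strict Implicit.
Unset Printing Implicit Defensive.

Import GRing.Theory.
Local Open Scope ring_scope.
Local Open Scope quotient_scope.

(* The zero ring is not a [comNzRingType], and [comAlgType] (hence also the   *)
(* codomain of [mmap]) excludes it too. To allow A-algebras that are possibly *)
(* zero, an A-algebra is here a [comPzRingType] B with a structure morphism   *)
(* {rmorphism A -> B}, and evaluation is [mmap] spelled out for such a B.     *)
Definition evalp (n : nat) (A : nzRingType) (B : comPzRingType)
    (iota : A -> B) (v : 'I_n -> B) (h : {mpoly A[n]}) : B :=
  \sum_(m <- msupp h) iota h@_m * \prod_(i < n) v i ^+ m i.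

Lemma evalp_mmap n (A : nzRingType) (B : comNzRingType) (iota : A -> B)
  (v : 'I_n -> B) (h : {mpoly A[n]}) : evalp iota v h = mmap iota v h.
Proof. by []. Qed.

Definition regular (A : pzRingType) (x : A) : Prop :=
  x <> 0 /\ ~ (exists2 y : A, y <> 0 & x * y = 0).

Section SplittingAlgebra.
Variables (A : comNzRingType) (n : nat) (f : {poly A}).

(* f_k, read off from f = t^n - f_1 t^(n-1) + ... + (-1)^n f_n. *)
Definition sgn_coef (k : nat) : A := (-1) ^+ k * f`_(n - k).

Lemma sgn_coefE : f \is monic -> size f = n.+1 ->
  f = 'X^n + \sum_(1 <= k < n.+1) (-1) ^+ k *: (sgn_coef k *: 'X^(n - k)).
Proof.
move=> /monicP lf sf; rewrite -[f in LHS]coefK poly_def sf big_ord_recr /=.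
rewrite addrC; congr (_ + _).
  by move: lf; rewrite lead_coefE sf /= => ->; rewrite scale1r.
rewrite -(big_mkord xpredT (fun i => f`_i *: 'X^i)) big_nat_rev /= add0n.
rewrite big_add1 /=; apply: eq_bigr => i _.
rewrite /sgn_coef scalerA mulrA -exprMn.
by rewrite mulrNN mulr1 expr1n mul1r.
Qed.

Definition split_rel (i : 'I_n) : {mpoly A[n]} :=
  mesym n A i.+1 - (sgn_coef i.+1)%:MP.

Definition split_ideal : {pred {mpoly A[n]}} := fun p =>
  `[< exists a : 'I_n -> {mpoly A[n]}, p = \sum_(i < n) a i * split_rel i >].

Lemma split_idealP p :
  reflect (exists a : 'I_n -> {mpoly A[n]}, p = \sum_(i < n) a i * split_rel i)
          (p \in split_ideal).
Proof. exact: asboolP. Qed.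

Lemma split_ideal_zmod : zmod_closed split_ideal.
Proof.
split=> [|p q /split_idealP[a ->] /split_idealP[b ->]]; apply/split_idealP.
  by exists (fun=> 0); rewrite big1 // => i _; rewrite mul0r.
exists (fun i => a i - b i); rewrite -sumrB.
by apply: eq_bigr => i _; rewrite mulrBl.
Qed.

HB.instance Definition _ :=
  GRing.isZmodClosed.Build {mpoly A[n]} split_ideal split_ideal_zmod.

Lemma split_idealMl p q : q \in split_ideal -> p * q \in split_ideal.
Proof.
move=> /split_idealP[a ->]; apply/split_idealP.
exists (fun i => p * a i); rewrite mulr_sumr.
by apply: eq_bigr => i _; rewrite mulrA.
Qed.

(* [ring_quotient] only makes the quotient by a proper ideal a ring, and a    *)
(* nonzero one; here only the additive quotient is taken from it.             *)
Definition split_alg : Type :=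
  {ideal_quot split_ideal}.

HB.instance Definition _ := GRing.Zmodule.on split_alg.

Definition split_pi (p : {mpoly A[n]}) : split_alg :=
  \pi_{ideal_quot split_ideal} p.
Definition split_repr (x : split_alg) : {mpoly A[n]} :=
  repr (x : {ideal_quot split_ideal}).

Lemma split_reprK : cancel split_repr split_pi.
Proof. exact: reprK. Qed.

Lemma split_pi_eq p q : (split_pi p = split_pi q) <-> (p - q \in split_ideal).
Proof. by rewrite Quotient.idealrBE; split=> /eqP. Qed.

Lemma split_repr_pi p : split_repr (split_pi p) - p \in split_ideal.
Proof. by apply/split_pi_eq; rewrite split_reprK. Qed.

Definition split_one : split_alg := split_pi 1.
Definition split_mul (x y : split_alg) : split_alg :=
  split_pi (split_repr x * split_repr y).

Lemma split_pi_zmod : zmod_morphism split_pi.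
Proof. by move=> p q; rewrite /split_pi raddfB. Qed.

HB.instance Definition _ :=
  GRing.isZmodMorphism.Build {mpoly A[n]} split_alg split_pi split_pi_zmod.

Lemma split_piM p q : split_pi (p * q) = split_mul (split_pi p) (split_pi q).
Proof.
apply/esym/split_pi_eq.
set p' := split_repr _; set q' := split_repr _.
have -> : p' * q' - p * q = p' * (q' - q) + q * (p' - p).
  by rewrite !mulrBr [q * p']mulrC [q * p]mulrC addrA subrK.
by rewrite rpredD // split_idealMl // split_repr_pi.
Qed.

Lemma split_mulA : associative split_mul.
Proof.
move=> x y z; rewrite -[x]split_reprK -[y]split_reprK -[z]split_reprK.
by rewrite -!split_piM mulrA.
Qed.

Lemma split_mulC : commutative split_mul.
Proof. by move=> x y; rewrite /split_mul mulrC. Qed.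

Lemma split_mul1 : left_id split_one split_mul.
Proof. by move=> x; rewrite -[x]split_reprK -split_piM mul1r. Qed.

Lemma split_mulDl : left_distributive split_mul +%R.
Proof.
move=> x y z; rewrite -[x]split_reprK -[y]split_reprK -[z]split_reprK.
by rewrite -raddfD -!split_piM mulrDl raddfD.
Qed.

HB.instance Definition _ := GRing.Zmodule_isComPzRing.Build split_alg
  split_mulA split_mulC split_mul1 split_mulDl.

Lemma split_pi_monoid : monoid_morphism split_pi.
Proof. by split=> // p q; exact: split_piM. Qed.

HB.instance Definition _ :=
  GRing.isMonoidMorphism.Build {mpoly A[n]} split_alg split_pi split_pi_monoid.

Definition split_in : A -> split_alg := split_pi \o @mpolyC n A.

HB.instance Definition _ := GRing.RMorphism.on split_in.

Definition split_root (i : 'I_n) : split_alg := split_pi 'X_i.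

Definition Dis : split_alg :=
  (-1) ^+ (n * (n - 1) %/ 2) *
    \prod_(i < n) \prod_(j < n | i != j) (split_root i - split_root j).

Lemma DisE : Dis =
  \prod_(i < n) \prod_(j < n | (j < i)%N) (split_root i - split_root j) ^+ 2.
Proof.
set tau := split_root.
have split_neq : \prod_(i < n) \prod_(j < n | i != j) (tau i - tau j) =
    \prod_(i < n) \prod_(j < n | (j < i)%N) (tau i - tau j) *
    \prod_(i < n) \prod_(j < n | (i < j)%N) (tau i - tau j).
  rewrite -big_split; apply: eq_bigr => i _ /=.
  rewrite (bigID (fun j : 'I_n => (j < i)%N)) /=.
  by congr (_ * _); apply: eq_bigl => j; rewrite -val_eqE /=; case: ltngtP.
have swap : \prod_(i < n) \prod_(j < n | (i < j)%N) (tau i - tau j) =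
    (-1) ^+ 'C(n, 2) *
    \prod_(i < n) \prod_(j < n | (j < i)%N) (tau i - tau j).
  rewrite (exchange_big_dep xpredT) //= -bin2_sum big_mkord.
  elim/big_ind3: _ => [|x k y x' k' y' -> ->|i _]; first by rewrite mulr1.
    by rewrite exprD mulrACA.
  under eq_bigr => j _ do rewrite -opprB.
  rewrite prodrN; congr (_ ^+ _ * _).
  rewrite -sum1_card -(big_ord_widen n (fun=> 1%N) (ltnW (ltn_ord i))).
  by rewrite sum1_card card_ord.
rewrite /Dis split_neq swap subn1 divn2 -bin2 mulrCA (mulrA (_ ^+ _)) -exprMn.
rewrite mulrNN mulr1 expr1n mul1r -big_split; apply: eq_bigr => i _ /=.
by rewrite -big_split; apply: eq_bigr => j _; rewrite expr2.
Qed.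

(* phi_s is induced by the substitution t_i |-> t_(s^-1 i), that is by        *)
(* [msym s^-1], which preserves the ideal.                                    *)
Definition split_act (s : 'S_n) (x : split_alg) : split_alg :=
  split_pi (msym s^-1%g (split_repr x)).

Lemma msym_split_ideal (s : 'S_n) p :
  p \in split_ideal -> msym s p \in split_ideal.
Proof.
move=> /split_idealP[a ->]; apply/split_idealP; exists (fun i => msym s (a i)).
rewrite raddf_sum; apply: eq_bigr => i _ /=.
rewrite msymM; congr (_ * _); rewrite raddfB /= /split_rel.
by have /issymP -> := mesym_sym n A i.+1; rewrite -alg_mpolyC linearZ rmorph1.
Qed.

Lemma split_act_pi s p : split_act s (split_pi p) = split_pi (msym s^-1%g p).
Proof.
apply/split_pi_eq; rewrite -raddfB; apply: msym_split_ideal.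
exact: split_repr_pi.
Qed.

Lemma split_act_zmod s : zmod_morphism (split_act s).
Proof.
move=> x y; rewrite -[x]split_reprK -[y]split_reprK -raddfB !split_act_pi.
by rewrite !raddfB.
Qed.

HB.instance Definition _ s :=
  GRing.isZmodMorphism.Build split_alg split_alg (split_act s)
    (split_act_zmod s).

Lemma split_act_monoid s : monoid_morphism (split_act s).
Proof.
split=> [|x y].
  by rewrite -[1 in LHS](rmorph1 split_pi) split_act_pi rmorph1.
rewrite -[x]split_reprK -[y]split_reprK -rmorphM !split_act_pi.
by rewrite !rmorphM.
Qed.

HB.instance Definition _ s :=
  GRing.isMonoidMorphism.Build split_alg split_alg (split_act s)
    (split_act_monoid s).

Lemma split_act_in s a : split_act s (split_in a) = split_in a.
Proof.
by rewrite /split_in /= split_act_pi -alg_mpolyC linearZ rmorph1.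
Qed.

Lemma split_act_root s i : split_act s (split_root i) = split_root (s^-1%g i).
Proof. by rewrite /split_root split_act_pi /msym mmapX mmap1U. Qed.

End SplittingAlgebra.

(* Main.v *)
Require Import Defs.
From HB Require Import structures.
From mathcomp Require Import all_boot all_order all_algebra all_fingroup.
From mathcomp Require Import mpoly.

Set Implicit Arguments.
Unset Strict Implicit.
Unset Printing Implicit Defensive.

Import GRing.Theory.
Local Open Scope ring_scope.

(** A symmetric polynomial is a polynomial in the elementary symmetric ones, and
these take the values f_k at the universal roots. Hence its value at the
universal roots lies in A; the discriminant is one such value, and the first
assertion follows by applying the homomorphism to B.

For the invariants, number the roots from 0 to n - 1. Suppose that x in A_f is fixed by the symmetric group, let
Alt(y) = \sum_s (-1)^s s(y), and let V = \det (tau_j ^ i) be the Vandermonde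
determinant of the universal roots, so that V ^ 2 = Dis(f). Since x is
invariant, Alt(x * \prod_i tau_i ^ i) = x * Alt(\prod_i tau_i ^ i) = x * V. On
the other hand Alt takes all its values in A * V ([alternator_vandermonde]).
Indeed A_f is generated as an A-module by the monomials \prod_i tau_i ^ e_i with
e_i <= i; Alt sends such a monomial to \det (tau_j ^ e_i), which vanishes as
soon as two exponents agree, and the only exponents e_i <= i that are pairwise
distinct are e_i = i. So x * V = a * V for some a in A, whence
Dis(f) * (x - a) = 0, and x = a provided that Dis(f) is a non-zero-divisor on
A_f and not just on A.

Two facts about A_f are used: the staircase monomials generate it, and every
non-zero-divisor of A is one on A_f. Both follow from the realization of A_f as
a tower ([splitting_tower]): adjoin to A one root x of f, that is form
A[t]/(f), divide f by t - x, and continue with the quotient. Each stage is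
generated over the one below by the powers of the new root with exponent less
than the degree of the polynomial at that stage, and a product with a constant
is computed there coefficient by coefficient. The tower has the universal
property of A_f, and the homomorphism from it to A_f given by that property
transfers both facts ([split_alg_tower]). *)

(** * Coefficients of a product of linear factors *)

Lemma mmap_mesym (A R : comNzRingType) n (j : {rmorphism A -> R})
    (r : 'I_n -> R) k :
  mmap j r (mesym n A k) = (mesym n R k).@[r].
Proof.
rewrite /mesym !rmorph_sum; apply: eq_bigr => h _ /=.
by rewrite !rmorph_prod; apply: eq_bigr => i _ /=; rewrite mmapX mmap1U mevalXU.
Qed.

Lemma prod_XsubC_coef (R : comNzRingType) n (r : 'I_n -> R) (k : 'I_n.+1) :
  (\prod_(i < n) ('X - (r i)%:P))`_(n - k) = (-1) ^+ k * (mesym n R k).@[r].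
Proof.
have -> : \prod_(i < n) ('X - (r i)%:P) =
    map_poly (mmap intr r) (\prod_(i < n) ('X - ('X_i)%:P)).
  rewrite rmorph_prod; apply: eq_bigr => i _.
  by rewrite rmorphB /= map_polyX map_polyC /= mmapX mmap1U.
rewrite Viete rmorph_sum coef_sum (bigD1 k) //= big1 => [|i neq_ik]; last first.
  rewrite !map_polyZ /= map_polyXn !coefZ coefXn.
  case: eqP => [eq_ik|_]; last by rewrite !mulr0.
  case/eqP: neq_ik; apply/val_inj => /=.
  by rewrite -(subKn (leq_ord i)) -eq_ik subKn // leq_ord.
rewrite addr0 !map_polyZ /= map_polyXn !coefZ coefXn eqxx mulr1 rmorph_sign.
by congr (_ * _); exact: mmap_mesym.
Qed.

Definition splits (A R : comNzRingType) (n : nat) (f : {poly A})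
    (j : A -> R) (r : 'I_n -> R) :=
  map_poly j f = \prod_(i < n) ('X - (r i)%:P).

Definition staircase (n : nat) (e : 'I_n -> nat) := forall i, (e i <= i)%N.

Definition non_zero_divisor (A : comPzRingType) (d : A) :=
  forall a, d * a = 0 -> a = 0.

(** Generation as a module is phrased as an induction principle: it transfers
along surjections and up a tower without any manipulation of coordinates. *)
Definition staircase_spanned (A C : comPzRingType) (n : nat)
    (iota : A -> C) (rho : 'I_n -> C) :=
  forall K : C -> Prop, (forall x y, K x -> K y -> K (x + y)) ->
    (forall a e, staircase e -> K (iota a * \prod_(i < n) rho i ^+ e i)) ->
    forall c, K c.

(** Viete's formulas: the roots of a splitting of f are exactly the zeros of the
relations that define the splitting algebra. *)
Lemma splits_rel (A R : comNzRingType) n (f : {poly A})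
    (j : {rmorphism A -> R}) (r : 'I_n -> R) :
  f \is monic -> size f = n.+1 ->
  splits f j r <-> forall i : 'I_n, mmap j r (split_rel f i) = 0.
Proof.
move=> f_monic f_size.
have coefE (k : 'I_n.+1) : ((map_poly j f)`_(n - k) ==
    (\prod_(i < n) ('X - (r i)%:P))`_(n - k)) =
    (mmap j r (mesym n A k) == j (sgn_coef n f k)).
  rewrite prod_XsubC_coef mmap_mesym coef_map /sgn_coef rmorphM rmorph_sign.
  by rewrite eq_sym (can2_eq (signrMK k) (signrMK k)).
split=> [f_split i|rel0].
  rewrite rmorphB /= mmapC; apply/eqP; rewrite subr_eq0.
  by rewrite -(coefE (lift ord0 i)) f_split.
apply/polyP => i; have [le_in|lt_ni] := leqP i n; last first.
  rewrite !nth_default // ?size_prod_XsubC ?size_map_poly_id0 ?f_size //.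
    by rewrite /index_enum -enumT size_enum_ord.
  by rewrite (monicP f_monic) rmorph1 oner_neq0.
(* The relations start at k = 1; k = 0 compares leading coefficients. *)
rewrite -(subKn le_in) -[(n - i)%N]/(val (Ordinal (leq_subr i n : _ < n.+1)%N)).
apply/eqP; rewrite coefE; case: (Ordinal _) => -[|k] /= lt_kn.
  rewrite mesym0E rmorph1 /sgn_coef mul1r subn0.
  by move/monicP: f_monic; rewrite lead_coefE f_size => ->; rewrite rmorph1.
have := rel0 (Ordinal (lt_kn : (k < n)%N)); rewrite rmorphB /= mmapC.
by move/eqP; rewrite subr_eq0.
Qed.

(** * Adjoining one root *)

Section Adjoin.

Variables (A : comNzRingType) (f : {poly A}).
Hypotheses (f_monic : f \is monic) (f_size : (1 < size f)%N).

Lemma mk_monic_id : mk_monic f = f.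
Proof. by rewrite /mk_monic f_size f_monic. Qed.

Lemma in_qpoly_horner (p : {poly A}) :
  in_qpoly f p = (map_poly (qpolyC f) p).['qX].
Proof.
elim/poly_ind: p => [|p c IHp]; first by rewrite !rmorph0 horner0.
rewrite !rmorphD !rmorphM /= map_polyX map_polyC hornerMXaddC -IHp.
congr (_ + _); apply/val_inj/in_qpoly_small.
exact: leq_ltn_trans (size_polyC_leq1 _) (size_mk_monic_gt1 f).
Qed.

Lemma qX_root : root (map_poly (qpolyC f) f) 'qX.
Proof.
rewrite /root -in_qpoly_horner; apply/eqP/val_inj.
by rewrite /= mk_monic_id Pdiv.RingMonic.rmodpp.
Qed.

Lemma qpoly_span (q : {poly %/ f}) :
  q = \sum_(k < (size f).-1) qpolyC f (q : {poly A})`_k * 'qX ^+ k.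
Proof.
have le_q : (size (q : {poly A}) <= (size f).-1)%N.
  by rewrite -{2}mk_monic_id size_npoly.
have {1}-> : q = in_qpoly f q.
  exact/val_inj/esym/in_qpoly_small/size_mk_monic.
rewrite in_qpoly_horner (@horner_coef_wide _ (size f).-1).
  by apply: eq_bigr => k _; rewrite coef_map.
exact: leq_trans (size_poly _ _) le_q.
Qed.

(** A product with a constant needs no reduction modulo f, so it can be read off
coefficientwise. *)
Lemma qpolyC_regular d :
  non_zero_divisor d -> non_zero_divisor (qpolyC f d).
Proof.
move=> d_reg q dq0; apply/val_inj/polyP => k; rewrite coef0; apply: d_reg.
have qpolyCE : qpolyC f d = d%:A by apply/val_inj; rewrite /= -mul_polyC mulr1.
move: dq0; rewrite qpolyCE mulr_algl.
move/(congr1 (fun p : {poly %/ f} => (p : {poly A})`_k)).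
by rewrite coefZ coef0.
Qed.

Variables (R : comNzRingType) (j : {rmorphism A -> R}) (r : R).

(** The proof that r is a root is an argument, as the map is multiplicative only
in that case. *)
Definition qpoly_eval of root (map_poly j f) r := fun q : {poly %/ f} =>
  (map_poly j q).[r].

Hypothesis r_root : root (map_poly j f) r.

Lemma qpoly_eval_in p : qpoly_eval r_root (in_qpoly f p) = (map_poly j p).[r].
Proof.
rewrite /qpoly_eval /= mk_monic_id.
rewrite {2}(Pdiv.RingMonic.rdivp_eq f_monic p) rmorphD rmorphM.
by rewrite hornerD hornerM (rootP r_root) mulr0 add0r.
Qed.

Lemma qpoly_eval_zmod : zmod_morphism (qpoly_eval r_root).
Proof. by move=> p q; rewrite /qpoly_eval /= rmorphB hornerD hornerN. Qed.

Lemma qpoly_eval_monoid : monoid_morphism (qpoly_eval r_root).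
Proof.
split=> [|p q]; first by rewrite /qpoly_eval /= rmorph1 hornerC.
by rewrite [p * q]/(in_qpoly f _) qpoly_eval_in rmorphM hornerM.
Qed.

HB.instance Definition _ := GRing.isZmodMorphism.Build {poly %/ f} R
  (qpoly_eval r_root) qpoly_eval_zmod.
HB.instance Definition _ := GRing.isMonoidMorphism.Build {poly %/ f} R
  (qpoly_eval r_root) qpoly_eval_monoid.

Lemma qpoly_universal : exists2 g : {rmorphism {poly %/ f} -> R},
  forall a, g (qpolyC f a) = j a & g 'qX = r.
Proof.
exists (qpoly_eval r_root) => [a|].
  by rewrite /= /qpoly_eval qpolyCE map_polyC hornerC.
by rewrite [LHS]qpoly_eval_in map_polyX hornerX.
Qed.

End Adjoin.

(** * The splitting algebra as a tower of one-root extensions *)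

Lemma monic_factor (R : comNzRingType) n (f g : {poly R}) (r : R) :
  f \is monic -> size f = n.+2 -> f = g * ('X - r%:P) ->
  g \is monic /\ size g = n.+1.
Proof.
move=> f_monic sf ef.
have g_monic : g \is monic.
  by rewrite -(monicMr _ (monicXsubC r)) -ef.
split=> //; move: sf; rewrite ef size_Mmonic ?monicXsubC ?monic_neq0 //.
by rewrite size_XsubC addn2 => -[].
Qed.

Definition ord_snoc n T (r : 'I_n -> T) (x : T) (i : 'I_n.+1) : T :=
  if unlift ord_max i is Some k then r k else x.

Lemma ord_snoc_widen n T (r : 'I_n -> T) x i :
  ord_snoc r x (widen_ord (leqnSn n) i) = r i.
Proof.
rewrite /ord_snoc; have -> : widen_ord (leqnSn n) i = lift ord_max i.
  by apply/val_inj/esym/lift_max.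
by rewrite liftK.
Qed.

Lemma ord_snoc_max n T (r : 'I_n -> T) x : ord_snoc r x ord_max = x.
Proof. by rewrite /ord_snoc unlift_none. Qed.

(** The root x adjoined first is put last, at index n - 1: over A its powers up
to x^(n-1) are needed, and the roots adjoined later satisfy polynomials of
smaller degree, which is what the bounds e_i <= i express. *)
Lemma splitting_tower n (A : comNzRingType) (f : {poly A}) :
  f \is monic -> size f = n.+1 ->
  exists (C : comNzRingType) (iota : {rmorphism A -> C}) (rho : 'I_n -> C),
  [/\ splits f iota rho,
      forall (R : comNzRingType) (j : {rmorphism A -> R}) (r : 'I_n -> R),
        splits f j r ->
        exists2 psi : {rmorphism C -> R},
          forall a, psi (iota a) = j a & forall i, psi (rho i) = r i,
      forall d, non_zero_divisor d -> non_zero_divisor (iota d)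
    & staircase_spanned iota rho].
Proof.
elim: n A f => [|n IHn] A f f_monic f_size.
  have f1 : f = 1.
    have /eqP/size_poly1P[c _ fc] := f_size.
    by move/monicP: f_monic; rewrite fc lead_coefC => ->.
  exists A, idfun, (fun _ => 0); split=> [|R j r _|d d_reg c|K _ Kgen c].
  - by rewrite /splits big_ord0 f1 rmorph1.
  - by exists j => // -[].
  - exact: d_reg.
  - by have := Kgen c (fun=> 0%N) (fun=> leq0n _); rewrite big_ord0 mulr1.
have f_size_gt1 : (1 < size f)%N by rewrite f_size.
pose iota1 : {rmorphism A -> {poly %/ f}} := qpolyC f.
have /factor_theorem[f1 f1E] := qX_root f_monic f_size_gt1.
have mf_size : size (map_poly iota1 f) = n.+2.
  by rewrite size_map_poly_id0 ?f_size // (monicP f_monic) rmorph1 oner_neq0.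
have [f1_monic f1_size] := monic_factor (monic_map iota1 f_monic) mf_size f1E.
have [C [iota' [rho' [C_split C_univ C_reg C_span]]]] :=
  IHn _ _ f1_monic f1_size.
exists C, (iota' \o iota1), (ord_snoc rho' (iota' 'qX)).
split=> [|R j r r_split|d d_reg c|K KD Kgen].
- rewrite /splits big_ord_recr /= ord_snoc_max map_poly_comp f1E rmorphM /=.
  rewrite C_split map_polyXsubC; congr (_ * _).
  by apply: eq_bigr => i _; rewrite ord_snoc_widen.
- have r_root : root (map_poly j f) (r ord_max).
    by rewrite r_split big_ord_recr /= /root hornerM hornerXsubC subrr mulr0.
  have [g gC gX] := qpoly_universal f_monic f_size_gt1 r_root.
  (* The quotient f1 splits over R: cancel the monic factor X - r_n. *)
  have [|psi psiC psiE] := C_univ R g (fun i => r (widen_ord (leqnSn n) i)).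
    apply: (monic_rreg (monicXsubC (r ord_max))) => /=.
    move: r_split; rewrite /splits big_ord_recr /= => <-.
    have -> : map_poly j f = map_poly g (map_poly iota1 f).
      by rewrite -map_poly_comp; apply: eq_map_poly => a; rewrite /= gC.
    by rewrite f1E rmorphM /= map_polyXsubC gX.
  exists psi => [a|i]; first by rewrite /= psiC gC.
  rewrite /ord_snoc; case: unliftP => [k|] ->; last by rewrite psiC gX.
  by rewrite psiE; congr r; apply/val_inj/esym/lift_max.
- by apply: C_reg; apply: qpolyC_regular.
(* Expand the coefficient q of a monomial in powers of the new root. *)
apply: C_span => // q e e_stair.
rewrite (qpoly_span f_monic f_size_gt1 q) f_size rmorph_sum mulr_suml /=.
elim/big_ind: _ => [||k _]; last 2 first.
- exact: KD.
- rewrite rmorphM rmorphXn /=.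
  have := Kgen q`_k (ord_snoc e k).
  rewrite big_ord_recr /= !ord_snoc_max => Kk.
  rewrite -mulrA [_ ^+ k * _]mulrC; move: Kk.
  under eq_bigr do rewrite !ord_snoc_widen.
  apply=> i; rewrite /ord_snoc; case: unliftP => [k'|] ->; last by rewrite -ltnS.
  by rewrite lift_max.
by have := Kgen 0 (fun=> 0%N) (fun=> leq0n _); rewrite rmorph0 mul0r.
Qed.

(** * Consequences for the splitting algebra *)

Section SplittingAlgebraTheory.

Variables (A : comNzRingType) (n : nat) (f : {poly A}).
Hypotheses (f_monic : f \is monic) (f_size : size f = n.+1).

Lemma mmap_split_ideal (R : comNzRingType) (j : {rmorphism A -> R})
    (r : 'I_n -> R) p :
  splits f j r -> p \in split_ideal f -> mmap j r p = 0.
Proof.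
move=> /(splits_rel j r f_monic f_size) rel0 /split_idealP[a ->].
by rewrite rmorph_sum big1 // => i _; rewrite rmorphM /= rel0 mulr0.
Qed.

(** A_f maps to the tower, which is a nonzero ring. *)
Lemma split_alg_nonzero : 1 != 0 :> split_alg n f.
Proof.
have [C [iota [rho [C_split _ _ _]]]] := splitting_tower f_monic f_size.
apply/eqP; rewrite -(rmorph1 (split_pi f)) -(rmorph0 (split_pi f)).
move/split_pi_eq; rewrite subr0 => /(mmap_split_ideal C_split).
by apply/eqP; rewrite rmorph1 oner_neq0.
Qed.

Lemma split_piE p : split_pi f p = evalp (split_in n f) (split_root f) p.
Proof.
rewrite {1}[p]mpolyE rmorph_sum; apply: eq_bigr => m _.
rewrite -mul_mpolyC rmorphM mpolyXE_id rmorph_prod; congr (_ * _).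
by apply: eq_bigr => i _; rewrite rmorphXn.
Qed.

Lemma split_mesym (i : 'I_n) :
  split_pi f (mesym n A i.+1) = split_in n f (sgn_coef n f i.+1).
Proof.
apply/split_pi_eq/split_idealP; exists (fun k => (k == i)%:R).
rewrite (bigD1 i) //= eqxx mul1r big1 ?addr0 // => k /negPf->.
by rewrite mul0r.
Qed.

(** The last property says that evaluation at rho is well defined as a map from
A_f to C, and the first one that psi is a left inverse of this map: so A_f
inherits regularity from C as a subring, and generation by monomials as a
quotient. *)
Lemma split_alg_tower :
  exists (C : comNzRingType) (iota : {rmorphism A -> C}) (rho : 'I_n -> C)
         (psi : {rmorphism C -> split_alg n f}),
  [/\ forall p, psi (mmap iota rho p) = split_pi f p,
      forall d, non_zero_divisor d -> non_zero_divisor (iota d),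
      staircase_spanned iota rho
    & forall p, p \in split_ideal f -> mmap iota rho p = 0].
Proof.
have [C [iota [rho [C_split C_univ C_reg C_span]]]] :=
  splitting_tower f_monic f_size.
(* The universal property of C is stated for nonzero rings. *)
pose R : comNzRingType := HB.pack (split_alg n f)
  (GRing.PzSemiRing_isNonZero.Build (split_alg n f) split_alg_nonzero).
pose j : {rmorphism A -> R} := split_in n f.
have [|psi psiC psiE] := C_univ R j (split_root f).
  apply/splits_rel => // i.
  rewrite -[LHS]/(evalp (split_in n f) (split_root f) _).
  by rewrite -split_piE rmorphB /= split_mesym subrr.
exists C, iota, rho, psi; split=> // [p|p]; last exact: mmap_split_ideal.
rewrite split_piE /mmap rmorph_sum; apply: eq_bigr => m _.
rewrite rmorphM psiC rmorph_prod; congr (_ * _).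
by apply: eq_bigr => i _; rewrite rmorphXn psiE.
Qed.

Lemma split_in_regular d :
  non_zero_divisor d -> non_zero_divisor (split_in n f d).
Proof.
have [C [iota [rho [psi [psiE C_reg _ ideal0]]]]] := split_alg_tower.
move=> d_reg x; rewrite -[x]split_reprK -[split_in n f d]/(split_pi f d%:MP).
rewrite -rmorphM -(rmorph0 (split_pi f)) => /split_pi_eq.
rewrite subr0 => /ideal0.
rewrite rmorphM /= mmapC => /C_reg-/(_ d_reg) p0.
by rewrite -psiE p0 !rmorph0.
Qed.

Lemma split_alg_span : staircase_spanned (split_in n f) (split_root f).
Proof.
have [C [iota [rho [psi [psiE _ C_span _]]]]] := split_alg_tower.
move=> K KD Kgen x; rewrite -[x]split_reprK -psiE.
apply: (C_span (fun c => K (psi c))) => [c c'|a e e_stair].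
  by rewrite rmorphD; exact: KD.
have psi_in : psi (iota a) = split_in n f a.
  by rewrite -[iota a](mmapC rho) psiE.
have psi_root i : psi (rho i) = split_root f i.
  by rewrite -[rho i](mmap1U rho) -(mmapX _ iota) psiE.
rewrite rmorphM rmorph_prod psi_in.
by under eq_bigr => i _ do rewrite rmorphXn psi_root; exact: Kgen.
Qed.

(** The fundamental theorem on symmetric polynomials, with the elementary ones
evaluated by [split_mesym]. *)
Lemma symmetric_split_in (h : {mpoly A[n]}) :
  h \is symmetric -> exists a, split_pi f h = split_in n f a.
Proof.
case/sym_fundamental => t [<- _].
exists t.@[fun i : 'I_n => sgn_coef n f i.+1].
rewrite comp_mpolyE mevalE !rmorph_sum; apply: eq_bigr => m _.
rewrite -mul_mpolyC !rmorphM !rmorph_prod; congr (_ * _).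
apply: eq_bigr => i _; rewrite !rmorphXn tnth_mktuple; congr (_ ^+ _).
exact: split_mesym.
Qed.

(** The double product over all i != j, unlike the one over i > j, is visibly
symmetric at the level of polynomials. *)
Lemma Dis_in : exists d, Dis n f = split_in n f d.
Proof.
pose h : {mpoly A[n]} := (-1) ^+ (n * (n - 1) %/ 2) *
  \prod_(i < n) \prod_(j < n | i != j) ('X_i - 'X_j).
have [|d h_d] := @symmetric_split_in h.
  apply/issymP => s; rewrite rmorphM rmorph_sign rmorph_prod; congr (_ * _).
  rewrite [RHS](reindex_perm s); apply: eq_bigr => i _.
  rewrite [RHS](reindex_perm s) rmorph_prod.
  apply: eq_big => [j|j _]; first by rewrite (inj_eq perm_inj).
  by rewrite rmorphB /= /msym !mmapX !mmap1U.
exists d; rewrite -h_d rmorphM rmorph_sign rmorph_prod; congr (_ * _).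
apply: eq_bigr => i _; rewrite rmorph_prod; apply: eq_bigr => j _.
by rewrite rmorphB.
Qed.

(** * Alternating sums and invariants *)

Definition alternator (x : split_alg n f) : split_alg n f :=
  \sum_(s : 'S_n) (-1) ^+ s * split_act s x.

Definition split_vandermonde : split_alg n f :=
  \det (Vandermonde n (\row_i split_root f i)).

Lemma Dis_vandermonde : Dis n f = split_vandermonde ^+ 2.
Proof.
rewrite DisE // /split_vandermonde det_Vandermonde -prodrXl.
under [RHS]eq_bigr do rewrite -prodrXl.
rewrite (exchange_big_dep xpredT) //=.
by apply: eq_bigr => i _; apply: eq_bigr => j _; rewrite !mxE.
Qed.

Lemma alternatorD x y : alternator (x + y) = alternator x + alternator y.
Proof.
by rewrite -big_split; apply: eq_bigr => s _; rewrite rmorphD mulrDr.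
Qed.

Lemma alternator_invariantM x y :
  (forall s : 'S_n, split_act s x = x) -> alternator (x * y) = x * alternator y.
Proof.
move=> x_inv; rewrite mulr_sumr; apply: eq_bigr => s _.
by rewrite rmorphM /= x_inv mulrCA.
Qed.

(** Leibniz's formula; s and its inverse have the same sign. *)
Lemma alternator_monomial (e : 'I_n -> nat) :
  alternator (\prod_(i < n) split_root f i ^+ e i) =
  \det (\matrix_(i, j) split_root f j ^+ e i).
Proof.
rewrite /alternator (reindex_inj invg_inj); apply: eq_bigr => s _.
rewrite odd_permV rmorph_prod; congr (_ * _); apply: eq_bigr => i _.
by rewrite rmorphXn /= split_act_root invgK mxE.
Qed.

(** By induction on i: the values below i are already taken, so e_i <= i must be
an equality. *)
Lemma staircase_inj (e : 'I_n -> nat) : staircase e -> injective e ->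
  forall i, e i = i.
Proof.
move=> e_stair e_inj [i lt_in]; elim/ltn_ind: i lt_in => i IHi lt_in.
have := e_stair (Ordinal lt_in); rewrite leq_eqVlt => /orP[/eqP //|lt_ei].
have lt_ein := ltn_trans lt_ei lt_in.
have /e_inj/(congr1 val) /= := IHi _ lt_ei lt_ein.
by move=> ei; rewrite ei ltnn in lt_ei.
Qed.

(** Either two rows of the determinant coincide, or it is the Vandermonde
determinant. *)
Lemma alternator_staircase (e : 'I_n -> nat) : staircase e ->
  exists a, alternator (\prod_(i < n) split_root f i ^+ e i) =
            split_in n f a * split_vandermonde.
Proof.
move=> e_stair; rewrite alternator_monomial.
have [e_inj|/injectivePn[i [i' neq_ii' eq_e]]] := altP (injectiveP e).
  exists 1; rewrite rmorph1 mul1r; congr (\det _); apply/matrixP => i j.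
  by rewrite !mxE (staircase_inj e_stair e_inj).
exists 0; rewrite rmorph0 mul0r.
by apply: (determinant_alternate neq_ii') => j; rewrite !mxE eq_e.
Qed.

Lemma alternator_vandermonde x :
  exists a, alternator x = split_in n f a * split_vandermonde.
Proof.
move: x; apply: split_alg_span => [x y [a xa] [b yb]|].
  by exists (a + b); rewrite alternatorD xa yb rmorphD mulrDl.
move=> a e /alternator_staircase[b Eb].
exists (a * b); rewrite alternator_invariantM => [|s].
  by rewrite Eb rmorphM mulrA.
exact: split_act_in.
Qed.

(** Multiplying x by the monomial \prod_i tau_i ^ i turns its alternating
sum, which is zero if n >= 2, into x times the Vandermonde determinant. *)
Lemma invariant_in d x : Dis n f = split_in n f d -> non_zero_divisor d ->
  (forall s : 'S_n, split_act s x = x) -> exists a, x = split_in n f a.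
Proof.
move=> Dis_d d_reg x_inv.
have [a] := alternator_vandermonde (x * \prod_(i < n) split_root f i ^+ i).
rewrite alternator_invariantM // (alternator_monomial (fun i => i)).
have <- : split_vandermonde = \det (\matrix_(i, j) split_root f j ^+ i).
  by congr (\det _); apply/matrixP => i k; rewrite !mxE.
move=> xa; exists a; apply/eqP; rewrite -subr_eq0; apply/eqP.
apply: (split_in_regular d_reg); rewrite -Dis_d Dis_vandermonde mulrC.
by rewrite mulrBl expr2 !mulrA xa subrr.
Qed.

End SplittingAlgebraTheory.

Lemma evalp_comp (A : nzRingType) (B C : comPzRingType) n (iota : A -> B)
    (phi : {rmorphism B -> C}) (v : 'I_n -> B) h :
  evalp (phi \o iota) (phi \o v) h = phi (evalp iota v h).
Proof.
rewrite rmorph_sum; apply: eq_bigr => m _; rewrite rmorphM rmorph_prod.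
by congr (_ * _); apply: eq_bigr => i _; rewrite rmorphXn.
Qed.

Theorem corollary2p5 (A : comNzRingType) (n : nat) (n_ge1 : (1 <= n)%N)
    (f : {poly A}) (f_monic : f \is monic) (f_size : size f = n.+1) :
  (forall (B : comPzRingType) (iotaB : {rmorphism A -> B})
      (phi : {rmorphism split_alg n f -> B}),
    (forall a : A, phi (split_in n f a) = iotaB a) ->
    forall h : {mpoly A[n]}, h \is symmetric ->
    exists a : A, evalp iotaB (fun i => phi (split_root f i)) h = iotaB a)
  /\ (exists d : A, Dis n f = split_in n f d)
  /\ (forall d : A, Dis n f = split_in n f d -> regular d ->
      forall x : split_alg n f,
        (forall s : 'S_n, split_act s x = x) <->
        (exists a : A, x = split_in n f a)).
Proof.
split=> [B iotaB phi phi_in h /(symmetric_split_in f)[a h_a]|].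
  exists a; rewrite -phi_in -h_a split_piE -evalp_comp.
  by apply: eq_bigr => m _; rewrite /= phi_in.
split=> [|d Dis_d [_ d_reg] x]; first exact: Dis_in.
split=> [|[a ->] s]; last exact: split_act_in.
apply: (invariant_in f_monic f_size Dis_d) => a da0.
by have [//|/eqP a_neq0] := eqVneq a 0; case: d_reg; exists a.
Qed.
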